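(* Let $\dot{H}$ be a totally disconnected graph of order $s$ and let $\mu$ be a non-zero real number. Then there exists a signed bipartite graph $\dot{\mathscr{B}}$ having $\dot{H}$ as a star complement for the eigenvalue $\mu$ if and only if $\mu^2$ is a positive integer and $s\geq \mu^2$.
   Context: A signed graph is a pair $(G,\Sigma^-)$ where $G$ is a finite simple graph (the underlying graph) and $\Sigma^-\subseteq E(G)$ is its set of negative edges; its adjacency matrix has entry $1$ for positive edges, $-1$ for negative edges and $0$ otherwise; its eigenvalues are those of this matrix. It is bipartite if $G$ is. The totally disconnected (signed) graph of order $s$ is $(sK_1,\emptyset)$, with $s$ vertices and no edges. If $\mu$ is an eigenvalue of a signed graph $(G,\Sigma^-)$ of multiplicity $k$, a star set for $\mu$ is a set $S\subseteq V(G)$ with $|S|=k$ such that $\mu$ is not an eigenvalue of the induced signed subgraph $(G,\Sigma^-)-S$; then $(G,\Sigma^-)-S$ is called a star complement for $\mu$ in $(G,\Sigma^-)$. *)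

(* Defs.v *)
From HB Require Import structures.
From mathcomp Require Import all_boot all_order all_algebra.
From mathcomp Require Import reals.

Set Implicit Arguments.
Unset Strict Implicit.
Unset Printing Implicit Defensive.

Import Order.TTheory GRing.Theory Num.Theory.
Local Open Scope ring_scope.

(* Edges are two-element vertex sets, so symmetry and the absence of loops
   and multiple edges are built in. *)
Record simple_graph := SimpleGraph {
  vertex : finType;
  edges : {set {set vertex}};
  card_edge : forall e, e \in edges -> #|e| = 2%N
}.

Record signed_graph := SignedGraph {
  underlying :> simple_graph;
  neg_edges : {set {set vertex underlying}};
  neg_edges_sub : neg_edges \subset edges underlying
}.

Definition bipartite (G : simple_graph) : Prop :=
  exists A : {set vertex G}, forall x y : vertex G,
    [set x; y] \in edges G -> (x \in A) != (y \in A).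

Definition adjacency (R : pzRingType) (G : signed_graph) :
    'M[R]_#|vertex G| :=
  \matrix_(i, j)
    let e := [set enum_val i; enum_val j] in
    if e \in edges G then (if e \in neg_edges G then -1 else 1) else 0.

Definition deleted_vertex (G : simple_graph) (S : {set vertex G}) : finType :=
  {x : vertex G | x \notin S}.

Definition deleted_edges (G : simple_graph) (S : {set vertex G})
    (E : {set {set vertex G}}) : {set {set deleted_vertex S}} :=
  [set e : {set deleted_vertex S} | [set val x | x in e] \in E].

Lemma deleted_card_edge (G : simple_graph) (S : {set vertex G}) e :
  e \in deleted_edges S (edges G) -> #|e| = 2%N.
Proof.
by rewrite inE => /card_edge; rewrite card_imset //; exact: val_inj.
Qed.

Definition delete_vertices_simple (G : simple_graph) (S : {set vertex G}) :
    simple_graph :=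
  SimpleGraph (@deleted_card_edge G S).

Lemma deleted_neg_edges_sub (G : signed_graph) (S : {set vertex G}) :
  deleted_edges S (neg_edges G) \subset edges (delete_vertices_simple S).
Proof.
apply/subsetP => e; rewrite !inE; exact: (subsetP (neg_edges_sub G)).
Qed.

Definition delete_vertices (G : signed_graph) (S : {set vertex G}) :
    signed_graph :=
  @SignedGraph (delete_vertices_simple S) _ (@deleted_neg_edges_sub G S).

Definition signed_iso (G H : signed_graph) : Prop :=
  exists2 f : vertex G -> vertex H, bijective f &
    forall e : {set vertex G},
      ([set f x | x in e] \in edges H) = (e \in edges G) /\
      ([set f x | x in e] \in neg_edges H) = (e \in neg_edges G).

Definition totally_disconnected (s : nat) (H : signed_graph) : Prop :=
  #|vertex H| = s /\ edges H = set0.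

(* The adjacency matrix is real symmetric, so the multiplicity of an
   eigenvalue is the dimension of its eigenspace. *)
Definition multiplicity (R : fieldType) (G : signed_graph) (mu : R) : nat :=
  \rank (eigenspace (adjacency R G) mu).

Definition star_set (R : fieldType) (mu : R) (G : signed_graph)
    (S : {set vertex G}) : Prop :=
  [/\ eigenvalue (adjacency R G) mu,
      #|S| = multiplicity G mu &
      ~~ eigenvalue (adjacency R (delete_vertices S)) mu].

(* As usual, a graph is identified with its isomorphic copies. *)
Definition star_complement (R : fieldType) (mu : R) (G H : signed_graph) :
    Prop :=
  exists2 S : {set vertex G}, star_set mu S & signed_iso (delete_vertices S) H.

(* Main.v *)
Require Import Defs.
From HB Require Import structures.
From mathcomp Require Import all_boot all_order all_algebra.
From mathcomp Require Import reals.

Set Implicit Arguments.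
Unset Strict Implicit.
Unset Printing Implicit Defensive.

Import Order.TTheory GRing.Theory Num.Theory.
Local Open Scope ring_scope.

(** Suppose that deleting a star set [S] for [mu] from a signed graph leaves no
    edges. An eigenvector for [mu != 0] that vanishes on [S] vanishes
    everywhere, so restriction to [S] is injective on the eigenspace; as its
    dimension is [#|S|], restriction is also onto
    ([eigenvector_indicator_on_star_set]). For [u] in [S], take the eigenvector
    [x] that is [1] at [u] and [0] on the rest of [S]. The eigenvalue equation
    at a vertex [h] outside [S] reads [a u h = mu * x h], and at [u] it reads
    [\sum_(h \notin S) x h * a h u = mu]. Hence [mu ^+ 2] is the sum of the
    [a u h ^+ 2], that is, the number of neighbours of [u] outside [S]
    ([sqr_eigenvalue_eq_degree]): an integer, positive since [mu != 0], and at
    most the order of the star complement.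

    Conversely, if [mu ^+ 2 = m] with [0 < m <= s], join a new vertex by
    positive edges to [m] of the [s] vertices. The result is a star with [m]
    leaves together with isolated vertices, for which both square roots of [m]
    are simple eigenvalues, and the centre is a star set. *)

(** * Adjacency entries indexed by vertices *)

(** The entry of the adjacency matrix at a pair of vertices, freed from the
    enumeration of the vertices. *)
Definition edge_sign (R : pzRingType) (G : signed_graph) (x y : vertex G) : R :=
  adjacency R G (enum_rank x) (enum_rank y).

Lemma edge_signE (R : pzRingType) (G : signed_graph) (x y : vertex G) :
  edge_sign R x y =
    if [set x; y] \in edges G then
      if [set x; y] \in neg_edges G then -1 else 1
    else 0.
Proof. by rewrite /edge_sign mxE !enum_rankK. Qed.

Lemma edge_signC (R : pzRingType) (G : signed_graph) (x y : vertex G) :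
  edge_sign R x y = edge_sign R y x.
Proof. by rewrite !edge_signE setUC. Qed.

Lemma edge_sign_sqr (R : pzRingType) (G : signed_graph) (x y : vertex G) :
  edge_sign R x y * edge_sign R x y = ([set x; y] \in edges G)%:R.
Proof.
rewrite edge_signE; case: ifP => _; last by rewrite mulr0.
by case: ifP => _; rewrite ?mulrNN mulr1.
Qed.

Lemma edge_sign_nonedge (R : pzRingType) (G : signed_graph) (x y : vertex G) :
  [set x; y] \notin edges G -> edge_sign R x y = 0.
Proof. by rewrite edge_signE => /negbTE ->. Qed.

Lemma loop_notin_edges (G : simple_graph) (x : vertex G) :
  [set x; x] \notin edges G.
Proof. by apply/negP => /card_edge; rewrite setUid cards1. Qed.

Lemma eigenspace_adjacencyP (R : fieldType) (G : signed_graph) (mu : R)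
    (v : 'rV[R]_#|vertex G|) :
  reflect (forall y, \sum_x v 0 (enum_rank x) * edge_sign R x y
                     = mu * v 0 (enum_rank y))
          (v <= eigenspace (adjacency R G) mu)%MS.
Proof.
have sumE y : (v *m adjacency R G) 0 (enum_rank y)
    = \sum_x v 0 (enum_rank x) * edge_sign R x y.
  rewrite mxE (reindex (@enum_rank (vertex G))) //.
  exact/onW_bij/enum_rank_bij.
apply: (iffP eigenspaceP) => [Ev y | Ev]; first by rewrite -sumE Ev mxE.
by apply/rowP => j; rewrite -(enum_valK j) sumE Ev mxE.
Qed.

Lemma edgeless_not_eigenvalue (R : fieldType) (G : signed_graph) (mu : R) :
  edges G = set0 -> mu != 0 -> ~~ eigenvalue (adjacency R G) mu.
Proof.
move=> G0 mu0; apply/eigenvalueP => -[v Ev]; apply/negP; rewrite negbK.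
have A0 : adjacency R G = 0 by apply/matrixP => i j; rewrite !mxE /= G0 in_set0.
by move/esym/eqP: Ev; rewrite A0 mulmx0 scaler_eq0 (negbTE mu0).
Qed.

(** * Edgeless star complements determine the eigenvalue *)

Lemma signed_iso_edgeless (G H : signed_graph) :
  signed_iso G H -> edges H = set0 -> edges G = set0.
Proof.
case=> f _ fE H0; apply/setP => e.
by rewrite -(fE e).1 H0 !inE.
Qed.

Lemma edge_meets_deleted (G : signed_graph) (S : {set vertex G}) :
  edges (delete_vertices S) = set0 ->
  forall x y, x \notin S -> y \notin S -> [set x; y] \notin edges G.
Proof.
move=> GS0 x y Sx Sy; apply/negP => Gxy.
pose x' : deleted_vertex S := Sub x Sx; pose y' : deleted_vertex S := Sub y Sy.
suff: [set x'; y'] \in edges (delete_vertices S) by rewrite GS0 inE.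
by rewrite inE imsetU1 imset_set1.
Qed.

Lemma eigenvector_indicator_on_star_set (R : fieldType) (G : signed_graph)
    (mu : R) (S : {set vertex G}) (u : vertex G) :
  mu != 0 -> #|S| = multiplicity G mu ->
  edges (delete_vertices S) = set0 ->
  u \in S ->
  exists2 v : 'rV_#|vertex G|, (v <= eigenspace (adjacency R G) mu)%MS &
    forall x, x \in S -> v 0 (enum_rank x) = (x == u)%:R.
Proof.
move=> mu0 cardS GS0 Su; set E := eigenspace (adjacency R _) _.
(* Right multiplication by P restricts a row vector to the coordinates in S. *)
pose P : 'M[R]_(#|vertex G|, #|S|) :=
  \matrix_(i, j) (i == enum_rank (enum_val j))%:R.
have PE (v : 'rV_#|vertex G|) j :
    (v *m P) 0 j = v 0 (enum_rank (enum_val j)).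
  rewrite mxE (bigD1 (enum_rank (enum_val j))) //= mxE eqxx mulr1.
  by rewrite big1 ?addr0 // => i /negbTE ne_ij; rewrite mxE ne_ij mulr0.
have inj_P : (E :&: kermx P)%MS = 0.
  apply/eqP/rowV0P => v; rewrite sub_capmx => /andP[].
  move=> /eigenspace_adjacencyP Ev /sub_kermxP vP0.
  have vS x : x \in S -> v 0 (enum_rank x) = 0.
    move=> Sx; have := PE v (enum_rank_in Sx x).
    by rewrite vP0 mxE enum_rankK_in.
  apply/rowP => j; rewrite -(enum_valK j) [RHS]mxE; set y := enum_val j.
  have [/vS // | Sy] := boolP (y \in S).
  apply: (mulfI mu0); rewrite -Ev mulr0 big1 // => x _.
  have [/vS -> | Sx] := boolP (x \in S); first by rewrite mul0r.
  by rewrite edge_sign_nonedge ?mulr0 //; exact: (edge_meets_deleted GS0).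
have full_EP : row_full (E *m P).
  have := mxrank_mul_ker E P; rewrite inj_P mxrank0 addn0 => rank_EP.
  by apply/eqP; rewrite rank_EP -/(multiplicity G mu) -cardS.
have /submxP[w wE] :
    ((delta_mx 0 (enum_rank_in Su u) : 'rV_#|S|) <= E *m P)%MS.
  exact: submx_full.
exists (w *m E) => [|x Sx]; first exact: submxMl.
have := PE (w *m E) (enum_rank_in Su x).
rewrite -mulmxA -wE enum_rankK_in // => <-.
rewrite mxE eqxx /=; congr (nat_of_bool _)%:R.
apply/eqP/eqP => [eq_xu | -> //].
by rewrite -(enum_rankK_in Su Sx) eq_xu enum_rankK_in.
Qed.

Lemma sqr_eigenvalue_eq_degree (R : fieldType) (G : signed_graph)
    (mu : R) (S : {set vertex G}) (u : vertex G) :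
  mu != 0 -> #|S| = multiplicity G mu ->
  edges (delete_vertices S) = set0 ->
  u \in S ->
  mu ^+ 2 = #|[set h in ~: S | [set u; h] \in edges G]|%:R.
Proof.
move=> mu0 cardS GS0 Su.
have [v /eigenspace_adjacencyP Ev vS] :=
  eigenvector_indicator_on_star_set mu0 cardS GS0 Su.
have v_out h : h \notin S -> mu * v 0 (enum_rank h) = edge_sign R u h.
  move=> Sh; rewrite -Ev (bigD1 u) //= vS // eqxx mul1r big1 ?addr0 // => x.
  move=> /negbTE ne_xu; have [Sx | Sx] := boolP (x \in S).
    by rewrite vS // ne_xu mul0r.
  by rewrite edge_sign_nonedge ?mulr0 //; exact: (edge_meets_deleted GS0).
have muE : mu = \sum_(h | h \notin S) v 0 (enum_rank h) * edge_sign R u h.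
  have := Ev u; rewrite vS // eqxx mulr1 => {1}<-.
  rewrite (bigID (mem S)) /= big1 ?add0r => [|x Sx].
    by apply: eq_bigr => h _; rewrite edge_signC.
  rewrite vS //; have [->|] := eqVneq x u; last by rewrite mul0r.
  by rewrite edge_sign_nonedge ?mulr0 // loop_notin_edges.
rewrite expr2 {2}muE mulr_sumr -sum1_card natr_sum.
rewrite (eq_bigl (fun h => (h \notin S) && ([set u; h] \in edges G))) =>
  [|h]; last by rewrite !inE.
rewrite big_mkcondr; apply: eq_bigr => h Sh.
by rewrite mulrA v_out // edge_sign_sqr; case: ifP.
Qed.

(** * A star with isolated vertices *)

Section StarGraph.

Variables (V : finType) (T : {set V}).

(** The star on [V] plus a centre [None], whose leaves are the vertices in
    [T]; the vertices outside [T] are isolated. *)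
Definition star_edges : {set {set option V}} :=
  [set [set None; Some h] | h in T].

Lemma star_card_edge e : e \in star_edges -> #|e| = 2%N.
Proof. by case/imsetP => h _ ->; rewrite cards2. Qed.

Definition star_graph : signed_graph :=
  @SignedGraph (SimpleGraph star_card_edge) set0 (sub0set _).

Lemma star_edge_None (h : V) :
  ([set None; Some h] \in star_edges) = (h \in T).
Proof.
apply/imsetP/idP => [[k Tk /setP/(_ (Some h))]|Th]; last by exists h.
by rewrite !inE eqxx /= => /esym/eqP[->].
Qed.

Lemma star_edge_Some (h k : V) : [set Some h; Some k] \notin star_edges.
Proof. by apply/imsetP => -[l _ /setP/(_ None)]; rewrite !inE. Qed.

Lemma star_bipartite : bipartite star_graph.
Proof.
exists [set None] => -[x|] [y|] //=; rewrite ?inE ?eqxx //.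
- by rewrite (negbTE (star_edge_Some _ _)).
- by rewrite (negbTE (loop_notin_edges (None : vertex star_graph))).
Qed.

Lemma star_edge_sign_center (R : pzRingType) (h : V) :
  @edge_sign R star_graph None (Some h) = (h \in T)%:R.
Proof. by rewrite edge_signE /= star_edge_None inE; case: ifP. Qed.

Lemma star_edge_sign_leaf (R : pzRingType) (h k : V) :
  @edge_sign R star_graph (Some h) (Some k) = 0.
Proof. by rewrite edge_sign_nonedge ?star_edge_Some. Qed.

(** Eigenvectors are determined by their value [c] at the centre: [c / mu] at
    each leaf and [0] at isolated vertices when [mu != 0]. *)
Lemma star_eigenspaceP (R : fieldType) (mu : R)
    (v : 'rV[R]_#|vertex star_graph|)
    (c := v 0 (enum_rank (None : vertex star_graph)))
    (l := fun h => v 0 (enum_rank (Some h : vertex star_graph))) :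
  (v <= eigenspace (adjacency R star_graph) mu)%MS <->
  \sum_(h in T) l h = mu * c /\
  forall h, c * (h \in T)%:R = mu * l h.
Proof.
have eq_None : \sum_(x : vertex star_graph)
    v 0 (enum_rank x) * edge_sign R x None = \sum_(h in T) l h.
  rewrite (bigD1 None) //= edge_sign_nonedge ?loop_notin_edges // mulr0 add0r.
  rewrite (reindex_omap Some id) => [|[] //] /=.
  rewrite [RHS]big_mkcond /=; apply: eq_big => [h|h _]; first by rewrite eqxx.
  by rewrite edge_signC star_edge_sign_center mulr_natr mulrb.
have eq_Some h : \sum_(x : vertex star_graph)
    v 0 (enum_rank x) * edge_sign R x (Some h) = c * (h \in T)%:R.
  rewrite (bigD1 None) //= star_edge_sign_center big1 ?addr0 // => -[k|] // _.
  by rewrite star_edge_sign_leaf mulr0.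
split=> [/eigenspace_adjacencyP Ev | [Ec El]].
  by split=> [|h]; [rewrite -eq_None Ev | rewrite -eq_Some Ev].
by apply/eigenspace_adjacencyP => -[h|]; rewrite ?eq_None ?eq_Some.
Qed.

Lemma star_multiplicity (R : fieldType) (mu : R) :
  mu != 0 -> mu ^+ 2 = #|T|%:R -> multiplicity star_graph mu = 1%N.
Proof.
move=> mu0 mu2; rewrite /multiplicity; set E := eigenspace (adjacency R _) _.
(* The value mu at the centre, 1 at each leaf and 0 at isolated vertices. *)
pose v : 'rV[R]_#|vertex star_graph| :=
  \row_j if enum_val j is Some h then (h \in T)%:R else mu.
have vNone : v 0 (enum_rank (None : vertex star_graph)) = mu.
  by rewrite mxE enum_rankK.
have vSome h : v 0 (enum_rank (Some h : vertex star_graph)) = (h \in T)%:R.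
  by rewrite mxE enum_rankK.
have Ev : (v <= E)%MS.
  apply/star_eigenspaceP; rewrite vNone; split=> [|h]; last by rewrite vSome.
  rewrite -expr2 mu2 -sum1_card natr_sum; apply: eq_bigr => h Th.
  by rewrite vSome Th.
have vE : (E <= v)%MS.
  apply/row_subP => i; move: (row i E) (row_sub i E) => w /star_eigenspaceP[_].
  set c := w 0 _ => wh; suff -> : w = (c / mu) *: v by exact: scalemx_sub.
  apply/rowP => j; rewrite -(enum_valK j) [RHS]mxE.
  case: (enum_val j : vertex star_graph) => [h|].
    by rewrite vSome; apply: (mulfI mu0); rewrite -wh mulrA mulrCA divff ?mulr1.
  by rewrite vNone divfK.
have v0 : v != 0 by apply: contraNneq mu0 => v0; rewrite -vNone v0 mxE.
have rank_v : \rank v = 1%N by rewrite rank_rV v0.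
by rewrite -rank_v; apply/eqP; rewrite eqn_leq !mxrankS.
Qed.

Lemma star_delete_center_edgeless :
  edges (delete_vertices ([set None] : {set vertex star_graph})) = set0.
Proof.
apply/setP => e; rewrite !inE; apply/imsetP => -[h _ eE].
have : None \in [set val x | x in e] by rewrite eE !inE.
by case/imsetP => x _ xE; have := valP x; rewrite -xE inE eqxx.
Qed.

Lemma star_center_star_set (R : fieldType) (mu : R) :
  mu != 0 -> mu ^+ 2 = #|T|%:R ->
  star_set mu ([set None] : {set vertex star_graph}).
Proof.
move=> mu0 mu2; have mult1 := star_multiplicity mu0 mu2; split.
- by rewrite /eigenvalue -mxrank_eq0 -/(multiplicity star_graph mu) mult1.
- by rewrite cards1 mult1.
- exact: edgeless_not_eigenvalue star_delete_center_edgeless mu0.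
Qed.

End StarGraph.

(** * The characterization *)

Lemma edgeless_signed_iso (G H : signed_graph) (f : vertex G -> vertex H) :
  bijective f -> edges G = set0 -> edges H = set0 -> signed_iso G H.
Proof.
move=> f_bij G0 H0; exists f => // e.
have neg0 (K : signed_graph) : edges K = set0 -> neg_edges K = set0.
  by move=> K0; apply/eqP; rewrite -subset0 -K0 neg_edges_sub.
by rewrite !neg0 // G0 H0 !inE.
Qed.

Lemma exists_subset_card (V : finType) (m : nat) :
  (m <= #|V|)%N -> exists T : {set V}, #|T| = m.
Proof.
move=> le_mV; exists [set x in take m (enum V)].
rewrite cardsE (card_uniqP _) ?take_uniq ?enum_uniq // size_takel //.
by rewrite -cardE.
Qed.

Theorem proposition3p1 (R : realType) (s : nat) (H : signed_graph) (mu : R)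
    (hH : totally_disconnected s H) (hmu : mu != 0) :
  (exists B : signed_graph, bipartite B /\ star_complement mu B H) <->
  ((exists m : nat, (0 < m)%N /\ mu ^+ 2 = m%:R) /\ mu ^+ 2 <= s%:R).
Proof.
case: hH => cardH H0; split=> [[B [_ [S [evB cardS _] isoH]]] | ].
  have BS0 := signed_iso_edgeless isoH H0.
  have /card_gt0P[u Su] : (0 < #|S|)%N.
    by rewrite cardS lt0n /multiplicity mxrank_eq0.
  have mu2 := sqr_eigenvalue_eq_degree hmu cardS BS0 Su.
  set N := [set h in _ | _] in mu2.
  have cardN : (#|N| <= s)%N.
    case: isoH => f /bij_eq_card cardf _; rewrite -cardH -cardf card_sig.
    by apply: subset_leq_card; apply/subsetP => h; rewrite !inE => /andP[].
  split; last by rewrite mu2 ler_nat.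
  exists #|N|; split=> //; rewrite lt0n; apply: contraNneq hmu => N0.
  by rewrite -sqrf_eq0 mu2 N0.
case=> -[m [_ mu2]]; rewrite mu2 ler_nat -cardH => /exists_subset_card[T cardT].
exists (star_graph T); split; first exact: star_bipartite.
rewrite -cardT in mu2.
exists [set None]; first exact: star_center_star_set.
pose D : finType := deleted_vertex ([set None] : {set vertex (star_graph T)}).
have out h : Some h \notin ([set None] : {set vertex (star_graph T)}).
  by rewrite inE.
pose g (h : vertex H) : D := Sub (Some h) (out h).
have g_bij : bijective g.
  apply: inj_card_bij => [h k /(congr1 val)[] // |].
  rewrite card_sig (@eq_card _ _ (predC1 None)) => [|x]; last by rewrite !inE.
  by rewrite cardC1 card_option.
case: g_bij => f gK fK.
apply: (@edgeless_signed_iso (delete_vertices _) H f) => //; first by exists g.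
exact: star_delete_center_edgeless.
Qed.
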